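(* Let $\hat\beta$ be the Lasso estimator with tuning parameter $\lambda>0$, let $\hat\Theta$ (and $\hat C,\hat T,\tilde T$) be obtained using the square root Lasso with tuning parameter $\lambda_0>0$, and let $\hat b:=\hat\beta+\hat\Theta^TX^T(Y-X\hat\beta)/n$ be the de-sparsified Lasso (see the context). Then $$\hat T^{-1}\tilde T^2(\hat b-\beta^0)=\hat T^{-1}\tilde T^2\hat\Theta^TX^T\epsilon/n+{\rm rem},\qquad\text{where } \|{\rm rem}\|_\infty\le\lambda_0\|\hat\beta-\beta^0\|_1 .$$ Hence, for constants $\lambda_{j,\epsilon},\lambda_\epsilon,\lambda_{\rm rem}\ge0$: for a fixed $j$, on the event $$\{|\hat c_j^TX^T\epsilon|/n\le\lambda_{j,\epsilon}\hat\tau_j,\ \lambda_0\|\hat\beta-\beta^0\|_1\le\lambda_{\rm rem}\}$$ we have $$\tilde\tau_j^2\,|\hat b_j-\beta_j^0|/\hat\tau_j\le\lambda_{j,\epsilon}+\lambda_{\rm rem},$$ and on the event $$\{\|\hat T^{-1}\hat C^TX^T\epsilon\|_\infty/n\le\lambda_\epsilon,\ \lambda_0\|\hat\beta-\beta^0\|_1\le\lambda_{\rm rem}\}$$ it holds that $$\|\hat T^{-1}\tilde T^2(\hat b-\beta^0)\|_\infty\le\lambda_\epsilon+\lambda_{\rm rem}.$$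
   Context: Linear model with fixed design: $Y=X\beta^0+\epsilon$, with $X$ a fixed $n\times p$ real matrix with columns $X_1,\dots,X_p$, $\beta^0\in\mathbb R^p$, $\epsilon\in\mathbb R^n$ a noise vector. For $v\in\mathbb R^n$, $\|v\|_n^2:=v^Tv/n$. The Lasso estimator is a minimizer $\hat\beta\in\arg\min_{\beta\in\mathbb R^p}\{\|Y-X\beta\|_n^2+2\lambda\|\beta\|_1\}$. For each $j$, $X_{-j}$ is $X$ without its $j$-th column, and the square root Lasso is $\hat\gamma_j\in\arg\min_{\gamma\in\mathbb R^{p-1}}\{\|X_j-X_{-j}\gamma\|_n+\lambda_0\|\gamma\|_1\}$ (entries $\hat\gamma_{k,j}$, $k\ne j$). Put $\hat\tau_j:=\|X_j-X_{-j}\hat\gamma_j\|_n$ (assumed positive for every $j$), $\lambda_j:=\lambda_0\hat\tau_j$, $\tilde\tau_j^2:=\hat\tau_j^2+\lambda_j\|\hat\gamma_j\|_1$, $\hat c_j\in\mathbb R^p$ with $j$-th entry $1$ and $k$-th entry $-\hat\gamma_{k,j}$ for $k\ne j$, and $\hat\theta_j:=\hat c_j/\tilde\tau_j^2$. Define $\hat C:=(\hat c_1,\dots,\hat c_p)$, $\hat\Theta:=(\hat\theta_1,\dots,\hat\theta_p)$ (columns), $\hat T:={\rm diag}(\hat\tau_1,\dots,\hat\tau_p)$, $\tilde T:={\rm diag}(\tilde\tau_1,\dots,\tilde\tau_p)$. ''On an event'' means that the inequality holds whenever the inequalities defining the event hold. *)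

(* Defs.v *)
From mathcomp Require Import all_boot all_order all_algebra.
From mathcomp Require Import reals.
From mathcomp Require Export matrix_normedtype.

Set Implicit Arguments.
Unset Strict Implicit.
Unset Printing Implicit Defensive.

Import Order.TTheory GRing.Theory Num.Theory.
Local Open Scope ring_scope.

(* The sup-norm is the library's [mx_norm] (the largest absolute value of an
   entry, and 0 for an empty matrix). *)

Definition is_argmin (R : realType) (T : Type) (f : T -> R) (x : T) : Prop :=
  forall y : T, f x <= f y.

Section Norms.
Variable R : realType.

Definition norm1 (m : nat) (v : 'cV[R]_m) : R := \sum_(i < m) `|v i 0|.

(* [(v^T *m v) 0 0] is the scalar v^T v, stored as a 1 x 1 matrix. *)
Definition normn (n : nat) (v : 'cV[R]_n) : R :=
  Num.sqrt ((v^T *m v) 0 0 / n%:R).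

End Norms.

Section Lasso.
Variables (R : realType) (n p : nat) (X : 'M[R]_(n, p)).

Definition is_lasso (Y : 'cV[R]_n) (lambda : R) (betahat : 'cV[R]_p) : Prop :=
  is_argmin (fun beta : 'cV[R]_p =>
               normn (Y - X *m beta) ^+ 2 + 2 * lambda * norm1 beta) betahat.

(* [col' j X] is X without its j-th column, so vectors gamma in R^(p-1) are
   indexed by 'I_(p.-1). *)
Definition is_sqrt_lasso (lambda0 : R) (j : 'I_p) (gammahat : 'cV[R]_p.-1) :
    Prop :=
  is_argmin (fun gamma : 'cV[R]_p.-1 =>
               normn (col j X - col' j X *m gamma) + lambda0 * norm1 gamma)
            gammahat.

End Lasso.

(* [gammahat j] is the vector of coefficients of the regression of the j-th
   column of X on the other columns. *)
Section Desparsified.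
Variables (R : realType) (n p : nat) (X : 'M[R]_(n, p)) (lambda0 : R).
Variable gammahat : 'I_p -> 'cV[R]_p.-1.

Definition tauhat (j : 'I_p) : R := normn (col j X - col' j X *m gammahat j).

Definition lambdaj (j : 'I_p) : R := lambda0 * tauhat j.

Definition tautilde (j : 'I_p) : R :=
  Num.sqrt (tauhat j ^+ 2 + lambdaj j * norm1 (gammahat j)).

(* [unlift j k] is [None] when k = j, and otherwise the index in 'I_(p.-1) of
   column k of X after deletion of column j. *)
Definition chat (j : 'I_p) : 'cV[R]_p :=
  \col_k (if unlift j k is Some k' then - gammahat j k' 0 else 1).

Definition thetahat (j : 'I_p) : 'cV[R]_p := (tautilde j ^+ 2)^-1 *: chat j.

Definition Chat : 'M[R]_p := \matrix_(k, j) chat j k 0.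
Definition Thetahat : 'M[R]_p := \matrix_(k, j) thetahat j k 0.
Definition That : 'M[R]_p := diag_mx (\row_j tauhat j).
Definition Ttilde : 'M[R]_p := diag_mx (\row_j tautilde j).

Definition desparsified (Y : 'cV[R]_n) (betahat : 'cV[R]_p) : 'cV[R]_p :=
  betahat + n%:R^-1 *: (Thetahat^T *m X^T *m (Y - X *m betahat)).

End Desparsified.

(* Main.v *)
Require Import Defs.
From mathcomp Require Import all_boot all_order all_algebra ring lra.
From mathcomp Require Import reals.

(* Minimality of gammahat_j at a segment towards an arbitrary g gives, by
   convexity of the l1 norm, the variational inequality
     r_j^T X_{-j} (g - gammahat_j) / n
       <= lambda_j (||g||_1 - ||gammahat_j||_1),
   with r_j := X_j - X_{-j} gammahat_j = X chat_j.  Taking g = 0 and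
   g = 2 gammahat_j yields r_j^T X_j / n = tautilde_j^2; taking
   g = gammahat_j + d and g = gammahat_j - d yields
   |r_j^T X_{-j} d| / n <= lambda_j ||d||_1.  Since
   tautilde_j^2 thetahat_j = chat_j, the remainder is
   (tautilde_j^2 delta_j - r_j^T X delta / n) / tauhat_j with
   delta := betahat - beta0, which only involves r_j^T X_{-j} delta_{-j}. *)

Set Implicit Arguments.
Unset Strict Implicit.
Unset Printing Implicit Defensive.

Import Order.TTheory GRing.Theory Num.Theory.
Local Open Scope ring_scope.

(** * Diagonal inverses, column splitting and the sup-norm *)

Lemma invmx_diag (F : fieldType) (n : nat) (d : 'rV[F]_n) :
  (forall j, d 0 j != 0) -> invmx (diag_mx d) = diag_mx (\row_j (d 0 j)^-1).
Proof.
move=> d_neq0.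
have dVK : diag_mx d *m diag_mx (\row_j (d 0 j)^-1) = 1%:M.
  apply/matrixP => i j; rewrite mul_diag_mx !mxE.
  by case: eqVneq => [_|_]; rewrite ?mulr1n ?mulr0n ?mulr0 ?divff.
have [d_unit _] := mulmx1_unit dVK.
by rewrite -[RHS](mulKmx d_unit) dVK mulmx1.
Qed.

(** Isolates the contribution of one coordinate; it is applied both to [chat] and to the estimation
    error. *)
Lemma mulmx_col'_row' (R : pzRingType) (n p : nat) (X : 'M[R]_(n, p))
    (v : 'cV[R]_p) (j : 'I_p) :
  X *m v = col j X *m row j v + col' j X *m row' j v.
Proof.
apply/matrixP => i k; rewrite !mxE (bigD1_ord j) //= big_ord1 !mxE.
by congr (_ + _); apply: eq_bigr => l _; rewrite !mxE.
Qed.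

Lemma mulmx_entry_row (R : pzSemiRingType) (m n p : nat) (A : 'M[R]_(m, n))
    (B : 'M[R]_(n, p)) i k :
  (A *m B) i k = (row i A *m B) 0 k.
Proof. by rewrite -row_mul [RHS]mxE. Qed.

(** Nonnegativity of [c] covers the empty matrix, whose norm is 0. *)
Lemma mx_norm_le (R : realDomainType) (m n : nat) (A : 'M[R]_(m, n)) (c : R) :
  0 <= c -> (forall i j, `|A i j| <= c) -> mx_norm A <= c.
Proof. by move=> c_ge0 leAc; rewrite mx_normrE; apply: bigmax_le. Qed.

Lemma ler_mx_norm_entry (R : realDomainType) (m n : nat) (A : 'M[R]_(m, n))
    i j :
  `|A i j| <= mx_norm A.
Proof.
by rewrite mx_normrE (le_bigmax _ (fun ij => `|A ij.1 ij.2|) (i, j)).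
Qed.

(** * The l1 norm *)

Section Norm1.
Variable R : realType.

Lemma norm1_ge0 (m : nat) (v : 'cV[R]_m) : 0 <= norm1 v.
Proof. by apply: sumr_ge0 => i _; apply: normr_ge0. Qed.

Lemma norm1D (m : nat) (u v : 'cV[R]_m) : norm1 (u + v) <= norm1 u + norm1 v.
Proof.
by rewrite /norm1 -big_split ler_sum// => i _; rewrite mxE ler_normD.
Qed.

Lemma norm1Z (m : nat) (a : R) (v : 'cV[R]_m) : norm1 (a *: v) = `|a| * norm1 v.
Proof.
by rewrite /norm1 mulr_sumr; apply: eq_bigr => i _; rewrite mxE normrM.
Qed.

Lemma norm1N (m : nat) (v : 'cV[R]_m) : norm1 (- v) = norm1 v.
Proof. by rewrite -scaleN1r norm1Z normrN1 mul1r. Qed.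

Lemma norm1_row' (m : nat) (v : 'cV[R]_m) j : norm1 (row' j v) <= norm1 v.
Proof.
rewrite [leRHS]/norm1 (bigD1_ord j) //= ler_wpDl//.
by apply: ler_sum => i _; rewrite mxE.
Qed.

End Norm1.

(** * The scaled inner product that induces [normn] *)

Section Dotn.
Variables (R : realType) (n : nat).
Implicit Types (u v w : 'cV[R]_n) (a : R).

Definition dotn u v : R := (u^T *m v) 0 0 / n%:R.

Lemma dotnC u v : dotn u v = dotn v u.
Proof. by rewrite /dotn -[u^T *m v]trmxK trmx_mul trmxK mxE. Qed.

Lemma dotnDr u v w : dotn u (v + w) = dotn u v + dotn u w.
Proof. by rewrite /dotn mulmxDr mxE mulrDl. Qed.

Lemma dotnZr a u v : dotn u (a *: v) = a * dotn u v.
Proof. by rewrite /dotn -scalemxAr mxE mulrA. Qed.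

Lemma dotnNr u v : dotn u (- v) = - dotn u v.
Proof. by rewrite -scaleN1r dotnZr mulN1r. Qed.

Lemma dotnBr u v w : dotn u (v - w) = dotn u v - dotn u w.
Proof. by rewrite dotnDr dotnNr. Qed.

Lemma dotn_ge0 v : 0 <= dotn v v.
Proof.
rewrite /dotn divr_ge0 ?ler0n// mxE sumr_ge0// => i _.
by rewrite mxE -expr2 sqr_ge0.
Qed.

Lemma sqr_normn v : normn v ^+ 2 = dotn v v.
Proof. by rewrite /normn sqr_sqrtr// dotn_ge0. Qed.

Lemma sqr_normnB u v :
  normn (u - v) ^+ 2 = normn u ^+ 2 - 2 * dotn u v + normn v ^+ 2.
Proof.
rewrite !sqr_normn dotnBr ![dotn (u - v) _]dotnC !dotnBr (dotnC v u).
by ring.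
Qed.

End Dotn.

(** * Optimality conditions of the square root Lasso *)

Section SqrtLassoOptimality.
Variables (R : realType) (n m : nat) (y : 'cV[R]_n) (A : 'M[R]_(n, m)).
Variables (mu : R) (gamma : 'cV[R]_m).
Let r := y - A *m gamma.
Hypotheses (mu_ge0 : 0 <= mu) (r_gt0 : 0 < normn r).
Hypothesis gamma_min :
  is_argmin (fun g : 'cV[R]_m => normn (y - A *m g) + mu * norm1 g) gamma.

(** A first-order condition obtained without differentiating the norm: a step of length [t] along
    the segment gives it up to an error of order [t], and [t] is then sent to 0. *)
Lemma sqrt_lasso_variational (g : 'cV[R]_m) :
  dotn r (A *m (g - gamma)) <= mu * normn r * (norm1 g - norm1 gamma).
Proof.
set h := A *m (g - gamma); set D := norm1 g - norm1 gamma.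
have step t : 0 < t -> t <= 1 ->
    dotn r h <= mu * normn r * D + t * normn h ^+ 2.
  move=> t_gt0 t_le1.
  have := gamma_min (gamma + t *: (g - gamma)).
  rewrite mulmxDr -scalemxAr opprD addrA -/r -/h => min_t.
  have conv : norm1 (gamma + t *: (g - gamma)) <= norm1 gamma + t * D.
    have -> : gamma + t *: (g - gamma) = (1 - t) *: gamma + t *: g.
      by rewrite scalerBr scalerBl scale1r addrA addrAC.
    apply: le_trans (norm1D _ _) _.
    rewrite !norm1Z !ger0_norm ?subr_ge0//; last exact: ltW.
    by rewrite /D; lra.
  have {}min_t : normn r - normn (r - t *: h) <= t * (mu * D).
    have := ler_wpM2l mu_ge0 conv; rewrite mulrDr mulrCA; lra.
  (* With a and b the norms of r and r - t h, a^2 - b^2 <= 2 a (a - b)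
     replaces the difference of norms by one of quadratic forms. *)
  have := sqr_normnB r (t *: h).
  rewrite (sqr_normn (t *: h)) !dotnZr [dotn (t *: h) _]dotnC dotnZr -sqr_normn.
  have := sqr_ge0 (normn r - normn (r - t *: h)).
  have := ler_wpM2l (ltW r_gt0) min_t.
  (* The expansion yields half of this quadratic term; its sign allows the factor 1/2 to be
     dropped. *)
  have : 0 <= t * (t * normn h ^+ 2) by rewrite mulrA -expr2 mulr_ge0 ?sqr_ge0.
  move: (normn (r - t *: h)) (normn r) (dotn r h) (normn h ^+ 2) => b a s H.
  move=> tH_ge0 ab_le sq_ge0 b2E.
  have : t * (s - mu * a * D) <= t * (t * H) by lra.
  by rewrite ler_pM2l//; lra.
apply/ler_addgt0Pr => e e_gt0.
(* The step length is [e / (e + normn h ^+ 2)]: it lies in (0, 1], makes the error at most [e], and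
   is well defined even when [h] is 0. *)
have H_ge0 : 0 <= normn h ^+ 2 by apply: sqr_ge0.
have d_gt0 : 0 < e + normn h ^+ 2 by lra.
have t_le1 : e / (e + normn h ^+ 2) <= 1 by rewrite ler_pdivrMr//; lra.
apply: le_trans (step _ (divr_gt0 e_gt0 d_gt0) t_le1) _.
rewrite lerD2l mulrAC -mulrA ger_pMr// ler_pdivrMr//; lra.
Qed.

(** The l1 norm is linear along the ray through [gamma], so moving inwards and outwards turns the
    variational inequality into an equality. *)
Lemma sqrt_lasso_dot_fit :
  dotn r (A *m gamma) = mu * normn r * norm1 gamma.
Proof.
have norm1_0 : norm1 (0 : 'cV[R]_m) = 0.
  by rewrite -(scale0r 0) norm1Z normr0 mul0r.
have := sqrt_lasso_variational 0.
have := sqrt_lasso_variational (2 *: gamma).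
rewrite sub0r mulmxN dotnNr norm1_0 norm1Z ger0_norm//.
have -> : 2 *: gamma - gamma = gamma
  by rewrite scalerDl scale1r addrK.
by move=> le_fit ge_fit; lra.
Qed.

(** Dual feasibility tested against a direction: the triangle inequality removes [gamma] from the
    bound, and the sign of [d] is free. *)
Lemma sqrt_lasso_dot_le (d : 'cV[R]_m) :
  `|dotn r (A *m d)| <= mu * normn r * norm1 d.
Proof.
have le_d (e : 'cV[R]_m) : dotn r (A *m e) <= mu * normn r * norm1 e.
  have := sqrt_lasso_variational (gamma + e); rewrite [gamma + e]addrC addrK.
  move=> /le_trans; apply; rewrite ler_wpM2l ?mulr_ge0 ?(ltW r_gt0)//.
  by rewrite lerBlDr; apply: norm1D.
rewrite ler_norml le_d andbT lerNl -dotnNr -mulmxN -(norm1N d).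
exact: le_d.
Qed.

End SqrtLassoOptimality.

(** * Error decomposition of the de-sparsified Lasso *)

Section Desparsified.
Variables (R : realType) (n p : nat) (X : 'M[R]_(n, p)) (lambda0 : R).
Variable gammahat : 'I_p -> 'cV[R]_p.-1.
Hypothesis lambda0_gt0 : 0 < lambda0.
Hypothesis gammahat_sqrt_lasso :
  forall j : 'I_p, is_sqrt_lasso X lambda0 j (gammahat j).
Hypothesis tauhat_gt0 : forall j : 'I_p, 0 < tauhat X gammahat j.

Local Notation tau := (tauhat X gammahat).
Local Notation tau' := (tautilde X lambda0 gammahat).

Lemma mulmx_chat j :
  X *m chat gammahat j = col j X - col' j X *m gammahat j.
Proof.
rewrite (mulmx_col'_row' _ _ j); congr (_ + _).
  apply/matrixP => i k; rewrite mxE big_ord1 !mxE.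
  by rewrite unlift_none mulr1.
rewrite -mulmxN; congr (_ *m _); apply/matrixP => i k.
by rewrite !mxE liftK ord1.
Qed.

Lemma sqr_tautilde j :
  tau' j ^+ 2 = tau j ^+ 2 + lambdaj X lambda0 gammahat j * norm1 (gammahat j).
Proof.
rewrite /tautilde sqr_sqrtr// addr_ge0 ?sqr_ge0// /lambdaj.
by rewrite !mulr_ge0 ?norm1_ge0// ltW.
Qed.

Lemma sqr_tautilde_gt0 j : 0 < tau' j ^+ 2.
Proof.
rewrite sqr_tautilde ltr_pwDl ?exprn_gt0// /lambdaj.
by rewrite !mulr_ge0 ?norm1_ge0// ltW.
Qed.

(** Column j is residual plus fit; the residual contributes the squared [tauhat] and the fit
    contributes the l1 term. This is why [thetahat] is normalized by the squared [tautilde]. *)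
Lemma dotn_chat_col j : dotn (X *m chat gammahat j) (col j X) = tau' j ^+ 2.
Proof.
rewrite mulmx_chat sqr_tautilde /lambdaj /tauhat.
rewrite -[X in dotn _ X](subrK (col' j X *m gammahat j)) dotnDr.
have -> := sqrt_lasso_dot_fit (ltW lambda0_gt0) (tauhat_gt0 j)
  (gammahat_sqrt_lasso j).
by rewrite -sqr_normn.
Qed.

(** Coordinate j cancels exactly, and dual feasibility bounds the rest. The factor [tau j] comes
    from [lambdaj]; dividing by it leaves a bound uniform in j. *)
Lemma dotn_chat_mulmx_le j (delta : 'cV[R]_p) :
  `|tau' j ^+ 2 * delta j 0 - dotn (X *m chat gammahat j) (X *m delta)|
    <= tau j * (lambda0 * norm1 delta).
Proof.
have -> : X *m delta = delta j 0 *: col j X + col' j X *m row' j delta.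
  rewrite (mulmx_col'_row' _ _ j); congr (_ + _).
  by apply/matrixP => i k; rewrite mxE big_ord1 !mxE ord1 mulrC.
rewrite dotnDr dotnZr dotn_chat_col mulrC opprD addrA subrr sub0r normrN.
rewrite mulmx_chat.
apply: le_trans (sqrt_lasso_dot_le (ltW lambda0_gt0) (tauhat_gt0 j)
  (gammahat_sqrt_lasso j) _) _.
rewrite mulrA [tau j * _]mulrC ler_wpM2l ?norm1_row'//.
exact: mulr_ge0 (ltW lambda0_gt0) (ltW (tauhat_gt0 j)).
Qed.

Lemma mulTheta_entry (w : 'cV[R]_n) j :
  tau' j ^+ 2 * ((Thetahat X lambda0 gammahat)^T *m X^T *m w) j 0
    = ((chat gammahat j)^T *m X^T *m w) 0 0.
Proof.
rewrite mulmx_entry_row row_mul.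
have -> : row j (Thetahat X lambda0 gammahat)^T
    = (tau' j ^+ 2)^-1 *: (chat gammahat j)^T.
  by apply/matrixP => i k; rewrite !mxE.
rewrite -!scalemxAl mxE mulrA divff ?mul1r//.
by rewrite gt_eqF// sqr_tautilde_gt0.
Qed.

Lemma mulC_entry (w : 'cV[R]_n) j :
  ((Chat gammahat)^T *m X^T *m w) j 0
    = ((chat gammahat j)^T *m X^T *m w) 0 0.
Proof.
rewrite mulmx_entry_row row_mul; congr ((_ *m _ *m _) _ _).
by apply/matrixP => i k; rewrite !mxE.
Qed.

Lemma desparsified_error (beta0 betahat : 'cV[R]_p) (eps : 'cV[R]_n) j :
  tau' j ^+ 2 *
    (desparsified X lambda0 gammahat (X *m beta0 + eps) betahat j 0 - beta0 j 0)
  = ((chat gammahat j)^T *m X^T *m eps) 0 0 / n%:R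
    + (tau' j ^+ 2 * (betahat - beta0) j 0
       - dotn (X *m chat gammahat j) (X *m (betahat - beta0))).
Proof.
have -> : desparsified X lambda0 gammahat (X *m beta0 + eps) betahat
    = betahat + n%:R^-1 *: ((Thetahat X lambda0 gammahat)^T *m X^T
                              *m (eps - X *m (betahat - beta0))).
  (* Under the linear model the Lasso residual is the noise minus the fitted estimation error. *)
  by rewrite /desparsified [X *m (_ - _)]mulmxBr opprB addrCA addrA.
rewrite mxE mxE addrAC mulrDr mulrCA mulTheta_entry mulmxBr.
(* Reads an entry of a difference while keeping the matrix products inside it folded. *)
have subE (m : nat) (u v : 'cV[R]_m) i : (u - v) i 0 = u i 0 - v i 0.
  by rewrite mxE [X in _ + X]mxE.
by rewrite /dotn trmx_mul !subE; ring.
Qed.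

End Desparsified.

(** * Normalized error: remainder and bounds on events *)

Theorem lemma2p3 (R : realType) (n p : nat) (X : 'M[R]_(n, p))
    (beta0 : 'cV[R]_p) (eps Y : 'cV[R]_n) (lambda lambda0 : R)
    (betahat : 'cV[R]_p) (gammahat : 'I_p -> 'cV[R]_p.-1)
    (model : Y = X *m beta0 + eps)
    (lambda_gt0 : 0 < lambda) (lambda0_gt0 : 0 < lambda0)
    (betahat_lasso : is_lasso X Y lambda betahat)
    (gammahat_sqrt_lasso :
       forall j : 'I_p, is_sqrt_lasso X lambda0 j (gammahat j))
    (tauhat_gt0 : forall j : 'I_p, 0 < tauhat X gammahat j) :
  let tau := tauhat X gammahat in
  let tau' := tautilde X lambda0 gammahat in
  let C := Chat gammahat in
  let Theta := Thetahat X lambda0 gammahat in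
  let T := That X gammahat in
  let T' := Ttilde X lambda0 gammahat in
  let bhat := desparsified X lambda0 gammahat Y betahat in
  [/\ exists rem : 'cV[R]_p,
        invmx T *m (T' *m T') *m (bhat - beta0) =
          n%:R^-1 *: (invmx T *m (T' *m T') *m Theta^T *m X^T *m eps) + rem
        /\ mx_norm rem <= lambda0 * norm1 (betahat - beta0),
      forall (j : 'I_p) (lambda_jeps lambda_rem : R),
        0 <= lambda_jeps -> 0 <= lambda_rem ->
        `|((chat gammahat j)^T *m X^T *m eps) 0 0| / n%:R
          <= lambda_jeps * tau j ->
        lambda0 * norm1 (betahat - beta0) <= lambda_rem ->
        tau' j ^+ 2 * `|bhat j 0 - beta0 j 0| / tau j
          <= lambda_jeps + lambda_rem
    & forall lambda_eps lambda_rem : R,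
        0 <= lambda_eps -> 0 <= lambda_rem ->
        mx_norm (invmx T *m C^T *m X^T *m eps) / n%:R <= lambda_eps ->
        lambda0 * norm1 (betahat - beta0) <= lambda_rem ->
        mx_norm (invmx T *m (T' *m T') *m (bhat - beta0))
          <= lambda_eps + lambda_rem].
Proof.
move=> tau tau' C Theta T T' bhat.
set delta := betahat - beta0.
have tau_neq0 j : tau j != 0 by rewrite gt_eqF.
have TVE : invmx T = diag_mx (\row_j (tau j)^-1).
  rewrite /T /That invmx_diag => [|j]; last by rewrite mxE.
  by congr diag_mx; apply/rowP => j; rewrite !mxE.
(* The normalizing matrix is diagonal, so it only rescales rows and every claim can be checked
   coordinatewise. *)
have WE m (A : 'M_(p, m)) i k :
    (invmx T *m (T' *m T') *m A) i k = tau' i ^+ 2 * A i k / tau i.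
  rewrite -!mulmxA TVE /T' /Ttilde !mul_diag_mx !mxE.
  by rewrite mulrC mulrA -expr2.
pose dev j := ((chat gammahat j)^T *m X^T *m eps) 0 0 / n%:R.
pose rem := \col_j ((tau' j ^+ 2 * delta j 0
                     - dotn (X *m chat gammahat j) (X *m delta)) / tau j).
(* All three claims rest on this split into noise and remainder. *)
have errE j : tau' j ^+ 2 * (bhat j 0 - beta0 j 0) / tau j
    = dev j / tau j + rem j 0.
  by rewrite /bhat model desparsified_error// [rem _ _]mxE mulrDl.
have rem_le j : `|rem j 0| <= lambda0 * norm1 delta.
  rewrite [rem _ _]mxE normrM normfV (gtr0_norm (tauhat_gt0 j)) ler_pdivrMr//.
  rewrite [leRHS]mulrC.
  exact: dotn_chat_mulmx_le.
have lam_norm_ge0 : 0 <= lambda0 * norm1 delta.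
  by rewrite mulr_ge0 ?norm1_ge0// ltW.
split.
- exists rem; split; last first.
    by apply: mx_norm_le => // i j; rewrite ord1 rem_le.
  apply/colP => j; rewrite [RHS]mxE [X in _ = X + _]mxE.
  (* Reassociation exposes the diagonal factor on the left, as [WE] requires. *)
  rewrite -(mulmxA _ Theta^T) -(mulmxA _ (Theta^T *m _)) !WE.
  rewrite [(bhat - _) j 0]mxE [(- beta0) j 0]mxE errE.
  rewrite /dev -(mulTheta_entry lambda0_gt0 tauhat_gt0); congr (_ + _).
  by rewrite mulrAC mulrC.
- move=> j lj lr _ _ dev_le lam_le.
  have -> : tau' j ^+ 2 * `|bhat j 0 - beta0 j 0| / tau j
      = `|tau' j ^+ 2 * (bhat j 0 - beta0 j 0) / tau j|.
    rewrite normrM normfV (gtr0_norm (tauhat_gt0 j)) normrM.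
    by rewrite (ger0_norm (sqr_ge0 _)).
  rewrite errE; apply: le_trans (ler_normD _ _) _.
  apply: lerD; last exact: le_trans (rem_le j) lam_le.
  (* The factor [tau j] in the event absorbs the normalization. *)
  rewrite normrM normfV (gtr0_norm (tauhat_gt0 j)) ler_pdivrMr//.
  by rewrite normrM normfV (ger0_norm (ler0n _ n)).
- move=> le lr le_ge0 lr_ge0 dev_le lam_le.
  apply: mx_norm_le => [|j k]; first exact: addr_ge0.
  rewrite ord1 WE [(bhat - _) j 0]mxE [(- beta0) j 0]mxE errE.
  apply: le_trans (ler_normD _ _) _.
  apply: lerD; last exact: le_trans (rem_le j) lam_le.
  apply: le_trans dev_le.
  (* The normalized noise term is an entry of the vector whose sup-norm the event controls. *)
  have -> : dev j / tau j = (invmx T *m C^T *m X^T *m eps) j 0 / n%:R.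
    rewrite -!mulmxA TVE mul_diag_mx !mulmxA mxE mulC_entry mxE.
    by rewrite /dev; ring.
  rewrite normrM normfV (ger0_norm (ler0n _ n)).
  by rewrite ler_wpM2r ?invr_ge0 ?ler0n// ler_mx_norm_entry.
Qed.
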